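(* Let $\overline{y}$ be the vector of all step values and internal stages computed by $K$ steps of the IDT (incremental direction technique) relaxation Runge-Kutta method, and let $\widetilde E$ be the associated reduced state-equation operator (see context). For any right-hand side $\overline{w}=(w_0,W_1,w_1,\dots,W_K,w_K)\in\mathbb R^{\overline N}$, the linearized IDT system $\widetilde E'(\overline y)\,\overline\delta=\overline w$ for $\overline\delta=(\delta_0,\Delta_1,\delta_1,\dots,\Delta_K,\delta_K)$ is given by the following time-stepping formulas (forward substitution): $\delta_0=w_0$ and, for $k=1,\dots,K$, $$\Delta_{k,i}=\delta_{k-1}+\Delta t\sum_{j=1}^s a_{ij}J_{k,j}\Delta_{k,j}+W_{k,i},\qquad i=1,\dots,s,$$ $$\delta_k=\delta_{k-1}+\gamma_k\,\Delta t\sum_{i=1}^s b_iJ_{k,i}\Delta_{k,i}+\rho_k\,\Delta t\sum_{i=1}^s b_iF_{k,i}+w_k,$$ where $$\rho_k=(\nabla_y\gamma_k)^\top\delta_{k-1}+(\nabla_Y\gamma_k)^\top\Delta_k .$$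
   Context: Consider the initial value problem $y'(t)=f(y(t),t)$, $0<t\le T$, $y(0)=y_{\rm init}\in\mathbb R^N$, with $f$ differentiable in $y$ and a smooth convex entropy function $\eta:\mathbb R^N\to\mathbb R$. Fix an $s$-stage Runge-Kutta method with coefficients $a_{ij},b_i,c_i$ ($1\le i,j\le s$), step size $\Delta t>0$, and times $t_k=t_{k-1}+\Delta t$. Vectors of length $\overline N=N+N(s+1)K$ are written in blocks as $\overline y=(y_0,Y_1,y_1,\dots,Y_K,y_K)$ with $y_k\in\mathbb R^N$ and $Y_k=(Y_{k,1},\dots,Y_{k,s})\in\mathbb R^{sN}$; the same convention is used for $\overline w=(w_0,W_1,w_1,\dots)$ and $\overline\delta=(\delta_0,\Delta_1,\delta_1,\dots)$ (the block $\Delta_k=(\Delta_{k,1},\dots,\Delta_{k,s})$ should not be confused with the step size $\Delta t$). Set $$F_{k,i}=f(Y_{k,i},t_{k-1}+c_i\Delta t),\qquad J_{k,i}=\frac{\partial f}{\partial y}(Y_{k,i},t_{k-1}+c_i\Delta t).$$ IDT method: $y_0=y_{\rm init}$ and, for $k=1,\dots,K$, $Y_{k,i}=y_{k-1}+\Delta t\sum_{j}a_{ij}F_{k,j}$ and $y_k=y_{k-1}+\gamma_k\Delta t\sum_i b_iF_{k,i}$, where the relaxation parameter $\gamma_k$ is the non-zero root closest to $1$ of $$r_k(\gamma;\overline y)=\eta\Big(y_{k-1}+\gamma\Delta t\sum_{i}b_iF_{k,i}\Big)-\eta(y_{k-1})-\gamma\Delta t\sum_{i}b_i\nabla\eta(Y_{k,i})^\top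 F_{k,i}.$$ The equation $r_k(\gamma_k;\overline y)=0$ implicitly defines $\gamma_k=\gamma_k(\overline y)$ as a differentiable function of $(y_{k-1},Y_k)$ only (these being regarded as independent variables); it is assumed that this root exists and $\partial r_k/\partial\gamma\ne0$ there. Its gradients are, by implicit differentiation, $$(\nabla_y\gamma_k)^\top=\frac{\partial\gamma_k}{\partial y_{k-1}}=-\Big(\frac{\partial r_k}{\partial\gamma}\Big)^{-1}\frac{\partial r_k}{\partial y_{k-1}},\qquad(\nabla_Y\gamma_{k,i})^\top=\frac{\partial\gamma_k}{\partial Y_{k,i}}=-\Big(\frac{\partial r_k}{\partial\gamma}\Big)^{-1}\frac{\partial r_k}{\partial Y_{k,i}},$$ evaluated at $\gamma=\gamma_k$, and $\nabla_Y\gamma_k=(\nabla_Y\gamma_{k,1},\dots,\nabla_Y\gamma_{k,s})\in\mathbb R^{sN}$. The reduced state-equation operator $\widetilde E:\mathbb R^{\overline N}\to\mathbb R^{\overline N}$ (defined near $\overline y$) has blocks, in the same ordering: initial block $y_0-y_{\rm init}$; and for each $k=1,\dots,K$ the stage blocks $Y_{k,i}-y_{k-1}-\Delta t\sum_ja_{ij}F_{k,j}$ ($i=1,\dots,s$) followed by the step block $y_k-y_{k-1}-\gamma_k(\overline y)\,\Delta t\sum_ib_iF_{k,i}$. $\widetilde E'(\overline y)$ denotes its Jacobian matrix, including the dependence of $\gamma_k$ on $\overline y$. *)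

(* Defs.v *)
From HB Require Import structures.
From mathcomp Require Import all_boot all_order all_algebra.
From mathcomp Require Import all_classical all_reals all_analysis.

Set Implicit Arguments.
Unset Strict Implicit.
Unset Printing Implicit Defensive.

Import Order.TTheory GRing.Theory Num.Theory.
Import numFieldNormedType.Exports.

Local Open Scope classical_set_scope.
Local Open Scope ring_scope.

(** Vectors are rows, and the library Jacobian ['J g x] acts on them from the
    right: [u *m 'J g x] is the product of the usual Jacobian matrix of [g] at
    [x] with the column vector [u]. *)

Section Calculus.
Context {R : realType} {m n : nat}.

Definition inner (A B : 'M[R]_(m, n)) : R := \sum_i \sum_j A i j * B i j.

Definition grad (g : 'M[R]_(m, n) -> R) (A : 'M[R]_(m, n)) : 'M[R]_(m, n) :=
  \matrix_(i, j) 'D_(delta_mx i j) g A.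

Fixpoint of_class (p : nat) (g : 'M[R]_(m, n) -> R) : Prop :=
  if p is q.+1 then
    (forall A, differentiable g A) /\
    (forall i j, of_class q (fun A => 'D_(delta_mx i j) g A))
  else continuous g.

Definition smooth (g : 'M[R]_(m, n) -> R) : Prop := forall p, of_class p g.

End Calculus.

Record tableau (R : realType) (s : nat) := Tableau {
  rka : 'M[R]_s;
  rkb : 'rV[R]_s;
  rkc : 'rV[R]_s
}.

(** Vectors [(y_0, Y_1, y_1, ..., Y_K, y_K)]: the part after [y_0] is the
    row-major flattening of [K] blocks, each of them the row-major flattening
    of the [(s + 1) x N] matrix with rows [Y_{k,1}, ..., Y_{k,s}, y_k]. *)
Notation bar_vec R N s K := 'rV[R]_(N + K * ((s + 1) * N)).

(** Comments number the steps from 1, as in [(y_0, Y_1, y_1, ...)], whereas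
    [k : 'I_K] starts at 0: the step with index [k] starts at time [k dt]. *)
Section Blocks.
Context {R : realType} {N s K : nat}.

Definition pack (y0 : 'rV[R]_N) (Y : 'I_K -> 'M[R]_(s, N))
    (y : 'I_K -> 'rV[R]_N) : bar_vec R N s K :=
  row_mx y0 (mxvec (\matrix_(k < K) mxvec (col_mx (Y k) (y k)))).

Definition block (y : bar_vec R N s K) (k : 'I_K) : 'M[R]_(s + 1, N) :=
  vec_mx (row k (vec_mx (rsubmx y))).

Definition init (y : bar_vec R N s K) : 'rV[R]_N := lsubmx y.

Definition stages (y : bar_vec R N s K) (k : 'I_K) : 'M[R]_(s, N) :=
  usubmx (block y k).

Definition step (y : bar_vec R N s K) (k : 'I_K) : 'rV[R]_N :=
  dsubmx (block y k).

(** The step value preceding block [k]: [y_0] for the first block, otherwise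
    the step value of the block before. *)
Definition prev_step (y : bar_vec R N s K) (k : 'I_K) : 'rV[R]_N :=
  if unlift ord0 (widen_ord (leqnSn K) k) is Some k' then step y k'
  else init y.

(** The variables [(y_{k-1}, Y_k)] on which [gamma_k] depends. *)
Definition local (y : bar_vec R N s K) (k : 'I_K) : 'rV[R]_N * 'M[R]_(s, N) :=
  (prev_step y k, stages y k).

End Blocks.

Section IDT.
Context {R : realType} {N s K : nat}.
Variables (f : 'rV[R]_N -> R -> 'rV[R]_N) (eta : 'rV[R]_N -> R).
Variables (rk : tableau R s) (dt : R).

Local Notation a := (rka rk).
Local Notation b := (rkb rk 0).
Local Notation c := (rkc rk 0).

Definition stage_time (k : 'I_K) (i : 'I_s) : R := k%:R * dt + c i * dt.

Definition stage_rhs (k : 'I_K) (Y : 'M[R]_(s, N)) (i : 'I_s) : 'rV[R]_N :=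
  f (row i Y) (stage_time k i).

Definition stage_jac (k : 'I_K) (Y : 'M[R]_(s, N)) (i : 'I_s) : 'M[R]_N :=
  'J (fun y => f y (stage_time k i)) (row i Y).

(** [r_k(g; z)] with [z = (y_{k-1}, Y_k)]. *)
Definition relax (k : 'I_K) (g : R) (z : 'rV[R]_N * 'M[R]_(s, N)) : R :=
  eta (z.1 + (g * dt) *: \sum_i b i *: stage_rhs k z.2 i)
  - eta z.1
  - g * dt * \sum_i b i * inner (grad eta (row i z.2)) (stage_rhs k z.2 i).

Definition relax_dgamma (k : 'I_K) (g : R) (z : 'rV[R]_N * 'M[R]_(s, N)) : R :=
  derive1 (fun h => relax k h z) g.

Definition relax_grad_y (k : 'I_K) (g : R) (z : 'rV[R]_N * 'M[R]_(s, N)) :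
    'rV[R]_N :=
  grad (fun y => relax k g (y, z.2)) z.1.

(** Row [i] is the gradient with respect to [Y_{k,i}]. *)
Definition relax_grad_Y (k : 'I_K) (g : R) (z : 'rV[R]_N * 'M[R]_(s, N)) :
    'M[R]_(s, N) :=
  grad (fun Y => relax k g (z.1, Y)) z.2.

Definition closest_root (k : 'I_K) (z : 'rV[R]_N * 'M[R]_(s, N)) (g : R) :
    Prop :=
  [/\ g != 0, relax k g z = 0 &
      forall h, h != 0 -> relax k h z = 0 -> `|g - 1| <= `|h - 1|].

Definition idt_solution (yinit : 'rV[R]_N) (y : bar_vec R N s K)
    (g : 'I_K -> R) : Prop :=
  init y = yinit /\
  forall k : 'I_K,
    [/\ forall i, row i (stages y k) =
          prev_step y k + dt *: \sum_j a i j *: stage_rhs k (stages y k) j,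
        step y k =
          prev_step y k + (g k * dt) *: \sum_i b i *: stage_rhs k (stages y k) i &
        closest_root k (local y k) (g k)].

Variable gamma : 'I_K -> 'rV[R]_N * 'M[R]_(s, N) -> R.

(** [gamma k] is the differentiable function of [(y_{k-1}, Y_k)] implicitly
    defined by [r_k = 0] near the point [local y k]. *)
Definition implicit_root (y : bar_vec R N s K) : Prop :=
  forall k : 'I_K,
    [/\ relax_dgamma k (gamma k (local y k)) (local y k) != 0,
        \forall z \near local y k, relax k (gamma k z) z = 0 &
        differentiable (gamma k) (local y k)].

Definition gamma_grad_y (k : 'I_K) (z : 'rV[R]_N * 'M[R]_(s, N)) : 'rV[R]_N :=
  grad (fun y => gamma k (y, z.2)) z.1.

(** Row [i] is the gradient with respect to [Y_{k,i}]. *)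
Definition gamma_grad_Y (k : 'I_K) (z : 'rV[R]_N * 'M[R]_(s, N)) :
    'M[R]_(s, N) :=
  grad (fun Y => gamma k (z.1, Y)) z.2.

Definition reduced_state (yinit : 'rV[R]_N) (y : bar_vec R N s K) :
    bar_vec R N s K :=
  pack (init y - yinit)
    (fun k => \matrix_(i < s)
       (row i (stages y k) - prev_step y k
        - dt *: \sum_j a i j *: stage_rhs k (stages y k) j))
    (fun k => step y k - prev_step y k
       - (gamma k (local y k) * dt)
           *: \sum_i b i *: stage_rhs k (stages y k) i).

Definition rho (y d : bar_vec R N s K) (k : 'I_K) : R :=
  inner (gamma_grad_y k (local y k)) (prev_step d k)
  + inner (gamma_grad_Y k (local y k)) (stages d k).

Definition forward_substitution (y w d : bar_vec R N s K) : Prop :=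
  init d = init w /\
  forall k : 'I_K,
    (forall i, row i (stages d k) =
       prev_step d k
       + dt *: (\sum_j a i j *:
                  (row j (stages d k) *m stage_jac k (stages y k) j))
       + row i (stages w k)) /\
    step d k =
      prev_step d k
      + (gamma k (local y k) * dt)
          *: (\sum_i b i *: (row i (stages d k) *m stage_jac k (stages y k) i))
      + (rho y d k * dt) *: (\sum_i b i *: stage_rhs k (stages y k) i)
      + step w k.

End IDT.

(* Main.v *)
Require Import Defs.
From HB Require Import structures.
From mathcomp Require Import all_boot all_order all_algebra.
From mathcomp Require Import all_classical all_reals all_analysis.

Import Order.TTheory GRing.Theory Num.Theory.
Import numFieldNormedType.Exports.

Local Open Scope classical_set_scope.
Local Open Scope ring_scope.

(** The two claims are instances of the chain rule.

    Gradients of [gamma_k]. Near [z = (y_{k-1}, Y_k)] the function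
    [u |-> r_k(gamma_k(u); u)] vanishes identically, so its differential at
    [z] is zero. As [r_k] is differentiable in [(g, u)] jointly
    ([differentiable_relax]; the gradient of the entropy appears in [r_k], so
    this uses second derivatives of the entropy), the chain rule splits that
    differential into [d_g r_k * d gamma_k + d_u r_k] ([implicit_diff]), and
    division by the nonzero number [d_g r_k] gives the formulas, coordinate by
    coordinate ([gamma_gradE]).

    Linearized system. Multiplying the row [d] by the Jacobian evaluates the
    differential of the reduced state operator at [d]. This differential is
    computed blockwise: the operator packs blocks built from the linear maps
    [init], [stages], [step], [prev_step], from the stage right-hand sides,
    whose differentials are the products with [J_{k,i}]
    ([is_diff_stage_rhs]), and from [gamma_k], whose differential in the
    direction [d] is exactly [rho_k] ([is_diff_gamma]). In the step block, the
    product rule applied to [gamma_k dt sum_i b_i F_{k,i}] produces the two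
    sums of the formula for [delta_k]. The result is [linearized_state]
    ([is_diff_reduced_state]), and comparing it with [w] block by block and
    moving the subtracted terms to the other side gives the time-stepping
    formulas ([linearized_state_eqP]). *)

Set Implicit Arguments.
Unset Strict Implicit.

(** * Differentials of matrix-valued maps *)

Section MatrixCalculus.
Context {R : realType}.
Implicit Types U V W : normedModType R.

Lemma is_diffE V W (g dg : V -> W) x : is_diff x g dg -> 'd g x =1 dg.
Proof. by move=> gx u; rewrite diff_val. Qed.

Lemma is_diff_ext V W (g g' dg dg' : V -> W) x :
  is_diff x g dg -> g =1 g' -> dg =1 dg' -> is_diff x g' dg'.
Proof. by move=> ? /funext <- /funext <-. Qed.

Lemma is_diff_continuous_linear V W (h : V -> W) x :
  linear h -> continuous h -> is_diff x h h.
Proof.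
move=> lin hc.
pose hM := GRing.isLinear.Build _ _ _ _ _ lin.
pose hL : {linear _ -> _} := HB.pack h hM.
apply: DiffDef; first exact: (linear_differentiable (f := hL)).
exact: (diff_lin (f := hL) x hc).
Qed.

Lemma is_diff_sum V W n (g dg : 'I_n -> V -> W) x :
  (forall i, is_diff x (g i) (dg i)) ->
  is_diff x (fun u => \sum_i g i u) (fun v => \sum_i dg i v).
Proof.
move=> gx; suff Sx : is_diff x (\sum_i g i) (\sum_i dg i).
  by apply: (is_diff_ext Sx) => u; rewrite fct_sumE.
apply: (big_ind2 (fun G dG : V -> W => is_diff x G dG)) => //.
- exact: is_diff_cst.
- by move=> *; exact: is_diffD.
Qed.

Lemma is_diff_coord V m n (g dg : V -> 'M[R]_(m, n)) x i j :
  is_diff x g dg -> is_diff x (fun u => g u i j) (fun v => dg v i j).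
Proof.
move=> gx.
have ij_d : is_diff (g x) (fun M : 'M[R]_(m, n) => M i j) (fun M => M i j).
  apply: is_diff_continuous_linear; first by move=> a M L; rewrite !mxE.
  exact: coord_continuous.
exact: (is_diff_comp gx ij_d).
Qed.

(** A linear map on matrices is a combination of finitely many coordinates, so
    its continuity need not be assumed. *)
Lemma is_diff_linear m n W (h : 'M[R]_(m, n) -> W) x :
  linear h -> is_diff x h h.
Proof.
move=> lin.
pose hM := GRing.isLinear.Build _ _ _ _ _ lin.
pose hL : {linear _ -> _} := HB.pack h hM.
have hE (M : 'M[R]_(m, n)) : \sum_i \sum_j M i j *: h (delta_mx i j) = h M.
  rewrite -[RHS]/(hL M) {2}[M]matrix_sum_delta linear_sum; apply: eq_bigr => i _.
  by rewrite linear_sum; apply: eq_bigr => j _; rewrite linearZ.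
apply: (is_diff_ext _ hE hE).
apply: is_diff_sum => i; apply: is_diff_sum => j.
have Mx := is_diff_coord i j (is_diff_id x).
exact: (is_diff_comp Mx (is_diff_scalel (x i j) (h (delta_mx i j)))).
Qed.

Lemma is_diff_linear_comp m n V W (h : 'M[R]_(m, n) -> W) g dg (x : V) :
  linear h -> is_diff x g dg -> is_diff x (fun u => h (g u)) (fun v => h (dg v)).
Proof. by move=> lin gx; exact: (is_diff_comp gx (is_diff_linear (g x) lin)). Qed.

Lemma is_diff_mx V m n (g dg : V -> 'M[R]_(m, n)) x :
  (forall i j, is_diff x (fun u => g u i j) (fun v => dg v i j)) ->
  is_diff x g dg.
Proof.
move=> gx.
suff Sx : is_diff x (fun u => \sum_i \sum_j g u i j *: delta_mx i j)
                    (fun u => \sum_i \sum_j dg u i j *: delta_mx i j).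
  by apply: (is_diff_ext Sx) => u; rewrite -matrix_sum_delta.
apply: is_diff_sum => i; apply: is_diff_sum => j.
exact: (is_diff_comp (gx i j) (is_diff_scalel _ _)).
Qed.

Lemma is_diff_mulr V (g h dg dh : V -> R) x :
  is_diff x g dg -> is_diff x h dh ->
  is_diff x (fun u => g u * h u) (fun v => dg v * h x + g x * dh v).
Proof.
move=> gx hx; apply: (is_diff_ext (is_diffM gx hx)) => // v /=.
by rewrite addrC mulrC.
Qed.

Lemma is_diff_scale V m n (g dg : V -> R) (h dh : V -> 'M[R]_(m, n)) x :
  is_diff x g dg -> is_diff x h dh ->
  is_diff x (fun u => g u *: h u) (fun v => dg v *: h x + g x *: dh v).
Proof.
move=> gx hx; apply: is_diff_mx => i j.
by apply: (is_diff_ext (is_diff_mulr gx (is_diff_coord i j hx))) => v; rewrite !mxE.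
Qed.

Lemma is_diff_inner V m n (g dg h dh : V -> 'M[R]_(m, n)) x :
  is_diff x g dg -> is_diff x h dh ->
  is_diff x (fun u => inner (g u) (h u))
            (fun v => inner (dg v) (h x) + inner (g x) (dh v)).
Proof.
move=> gx hx.
suff Sx : is_diff x (fun u => inner (g u) (h u))
    (fun v => \sum_i \sum_j (dg v i j * h x i j + g x i j * dh v i j)).
  apply: (is_diff_ext Sx) => // v; rewrite /inner -big_split.
  by apply: eq_bigr => i _; rewrite -big_split.
apply: is_diff_sum => i; apply: is_diff_sum => j.
by apply: is_diff_mulr; exact: is_diff_coord.
Qed.

Lemma is_diff_row V m n (g dg : V -> 'M[R]_(m, n)) x i :
  is_diff x g dg -> is_diff x (fun u => row i (g u)) (fun v => row i (dg v)).
Proof. by apply: is_diff_linear_comp => a u v; rewrite linearP. Qed.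

Lemma is_diff_matrix_rows V m n (g dg : V -> 'I_m -> 'rV[R]_n) x :
  (forall i, is_diff x (g^~ i) (dg^~ i)) ->
  is_diff x (fun u => \matrix_(i < m) g u i) (fun v => \matrix_(i < m) dg v i).
Proof.
move=> gx; apply: is_diff_mx => i j.
by apply: (is_diff_ext (is_diff_coord 0 j (gx i))) => u; rewrite mxE.
Qed.

Lemma is_diff_row_mx V m n1 n2 (g dg : V -> 'M[R]_(m, n1))
    (h dh : V -> 'M[R]_(m, n2)) x :
  is_diff x g dg -> is_diff x h dh ->
  is_diff x (fun u => row_mx (g u) (h u)) (fun v => row_mx (dg v) (dh v)).
Proof.
move=> gx hx; apply: is_diff_mx => i j; case: (split_ordP j) => k ->.
  by apply: (is_diff_ext (is_diff_coord i k gx)) => u; rewrite row_mxEl.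
by apply: (is_diff_ext (is_diff_coord i k hx)) => u; rewrite row_mxEr.
Qed.

Lemma is_diff_col_mx V m1 m2 n (g dg : V -> 'M[R]_(m1, n))
    (h dh : V -> 'M[R]_(m2, n)) x :
  is_diff x g dg -> is_diff x h dh ->
  is_diff x (fun u => col_mx (g u) (h u)) (fun v => col_mx (dg v) (dh v)).
Proof.
move=> gx hx; apply: is_diff_mx => i j; case: (split_ordP i) => k ->.
  by apply: (is_diff_ext (is_diff_coord k j gx)) => u; rewrite col_mxEu.
by apply: (is_diff_ext (is_diff_coord k j hx)) => u; rewrite col_mxEd.
Qed.

Lemma diff_grad m n (g : 'M[R]_(m, n) -> R) A :
  differentiable g A -> forall H, 'd g A H = inner (grad g A) H.
Proof.
move=> gA H; rewrite {1}[H]matrix_sum_delta linear_sum; apply: eq_bigr => i _.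
rewrite linear_sum; apply: eq_bigr => j _.
by rewrite linearZ /grad mxE deriveE // mulrC.
Qed.

(** * Partial differentials and implicit differentiation *)

Lemma is_diff_fst U V W (g : U -> V * W) dg x :
  is_diff x g dg -> is_diff x (fun u => (g u).1) (fun v => (dg v).1).
Proof.
move=> gx; have fst_d : is_diff (g x) fst fst.
  by apply: is_diff_continuous_linear => // z; exact: cvg_fst.
exact: (is_diff_comp gx fst_d).
Qed.

Lemma is_diff_snd U V W (g : U -> V * W) dg x :
  is_diff x g dg -> is_diff x (fun u => (g u).2) (fun v => (dg v).2).
Proof.
move=> gx; have snd_d : is_diff (g x) snd snd.
  by apply: is_diff_continuous_linear => // z; exact: cvg_snd.
exact: (is_diff_comp gx snd_d).
Qed.

Lemma is_diff_partial1 U V W (g : U * V -> W) (z : U * V) :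
  differentiable g z ->
  is_diff (z.1) (fun y : U => g (y, z.2)) (fun u => 'd g z (u, 0)).
Proof.
case: z => a b /= /differentiableP gab.
exact: (is_diff_comp (is_diff_pair (is_diff_id a) (is_diff_cst b a)) gab).
Qed.

Lemma is_diff_partial2 U V W (g : U * V -> W) (z : U * V) :
  differentiable g z ->
  is_diff (z.2) (fun y : V => g (z.1, y)) (fun v => 'd g z (0, v)).
Proof.
case: z => a b /= /differentiableP gab.
exact: (is_diff_comp (is_diff_pair (is_diff_cst a b) (is_diff_id b)) gab).
Qed.

Lemma differentiable_partial1 U V W (g : U * V -> W) (z : U * V) :
  differentiable g z -> differentiable (fun y : U => g (y, z.2)) (z.1).
Proof. by move=> /is_diff_partial1 gz; exact: ex_diff. Qed.

Lemma differentiable_partial2 U V W (g : U * V -> W) (z : U * V) :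
  differentiable g z -> differentiable (fun y : V => g (z.1, y)) (z.2).
Proof. by move=> /is_diff_partial2 gz; exact: ex_diff. Qed.

Lemma diff_partial1 U V W (g : U * V -> W) (z : U * V) u :
  differentiable g z -> 'd (fun y : U => g (y, z.2)) (z.1) u = 'd g z (u, 0).
Proof. by move=> /is_diff_partial1 /is_diffE. Qed.

Lemma diff_partial2 U V W (g : U * V -> W) (z : U * V) v :
  differentiable g z -> 'd (fun y : V => g (z.1, y)) (z.2) v = 'd g z (0, v).
Proof. by move=> /is_diff_partial2 /is_diffE. Qed.

(** Along the graph of [ga] the function [G] is constant near [z], so the
    differential of [u |-> G (ga u, u)] vanishes; linearity of ['d G] splits
    it into the two partial contributions. *)
Lemma implicit_diff V (G : R * V -> R) (ga : V -> R) z :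
  differentiable G (ga z, z) -> differentiable ga z ->
  (\forall u \near z, G (ga u, u) = 0) -> forall e,
  'd ga z e * derive1 (fun h => G (h, z)) (ga z)
    + 'd (fun u => G (ga z, u)) z e = 0.
Proof.
move=> Gd gd G0 e.
have HD := is_diff_comp
  (is_diff_pair (differentiableP gd) (is_diff_id z)) (differentiableP Gd).
have D0 : 'd G (ga z, z) ('d ga z e, e) = 0.
  rewrite -[LHS](is_diffE HD e) -deriveE; last exact: ex_diff.
  rewrite (near_eq_derive (g := fun=> 0)); last exact: G0.
  exact: derive_cst.
rewrite derive1E'; last exact: (differentiable_partial1 (z := (ga z, z))).
have -> := diff_partial1 (z := (ga z, z)) 1 Gd.
have -> := diff_partial2 (z := (ga z, z)) e Gd.
rewrite -['d ga z e * _]linearZ -linearD -[RHS]D0; congr ('d G _ _).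
by congr pair; rewrite /= ?addr0 ?scaler0 ?add0r //; exact: mulr1.
Qed.

End MatrixCalculus.

(** * Block vectors *)

Section Blocks.
Context {R : realType} {N s K : nat}.
Implicit Types y w : bar_vec R N s K.

Lemma block_linear (k : 'I_K) : linear (fun y => block y k).
Proof. by move=> a u v; rewrite /block !linearP. Qed.

Lemma init_linear : linear (fun y => init y).
Proof. by move=> a u v; rewrite /init linearP. Qed.

Lemma stages_linear (k : 'I_K) : linear (fun y => stages y k).
Proof. by move=> a u v; rewrite /stages block_linear linearP. Qed.

Lemma step_linear (k : 'I_K) : linear (fun y => step y k).
Proof. by move=> a u v; rewrite /step block_linear linearP. Qed.

Lemma prev_step_linear (k : 'I_K) : linear (fun y => prev_step y k).
Proof.
move=> a u v; rewrite /prev_step.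
by case: unlift => [j|]; rewrite ?step_linear ?init_linear.
Qed.

Lemma init_pack (y0 : 'rV[R]_N) (Y : 'I_K -> 'M[R]_(s, N)) (y : 'I_K -> 'rV[R]_N) :
  init (pack y0 Y y) = y0.
Proof. by rewrite /init row_mxKl. Qed.

Lemma block_pack (y0 : 'rV[R]_N) (Y : 'I_K -> 'M[R]_(s, N)) (y : 'I_K -> 'rV[R]_N) k :
  block (pack y0 Y y) k = col_mx (Y k) (y k).
Proof. by rewrite /block row_mxKr mxvecK rowK mxvecK. Qed.

Lemma stages_pack (y0 : 'rV[R]_N) (Y : 'I_K -> 'M[R]_(s, N)) (y : 'I_K -> 'rV[R]_N) k :
  stages (pack y0 Y y) k = Y k.
Proof. by rewrite /stages block_pack col_mxKu. Qed.

Lemma step_pack (y0 : 'rV[R]_N) (Y : 'I_K -> 'M[R]_(s, N)) (y : 'I_K -> 'rV[R]_N) k :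
  step (pack y0 Y y) k = y k.
Proof. by rewrite /step block_pack col_mxKd. Qed.

Lemma pack_eta w : pack (init w) (stages w) (step w) = w.
Proof.
rewrite /pack -[RHS]hsubmxK; congr row_mx.
rewrite -[RHS]vec_mxK; congr mxvec; apply/row_matrixP => k.
by rewrite rowK vsubmxK vec_mxK.
Qed.

Lemma pack_eqP (y0 : 'rV[R]_N) (Y : 'I_K -> 'M[R]_(s, N)) (y : 'I_K -> 'rV[R]_N) w :
  pack y0 Y y = w <->
  y0 = init w /\ forall k, Y k = stages w k /\ y k = step w k.
Proof.
split=> [<-|[-> Yy]].
  by rewrite init_pack; split=> // k; rewrite stages_pack step_pack.
by rewrite -[RHS]pack_eta; congr pack; apply/funext => k; have [] := Yy k.
Qed.

Lemma is_diff_pack (V : normedModType R) (x : V)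
    (y0 dy0 : V -> 'rV[R]_N) (Y dY : V -> 'I_K -> 'M[R]_(s, N))
    (y dy : V -> 'I_K -> 'rV[R]_N) :
  is_diff x y0 dy0 ->
  (forall k, is_diff x (fun u => Y u k) (fun v => dY v k)) ->
  (forall k, is_diff x (fun u => y u k) (fun v => dy v k)) ->
  is_diff x (fun u => pack (y0 u) (Y u) (y u))
    (fun v => pack (dy0 v) (dY v) (dy v)).
Proof.
move=> d0 dYx dyx; rewrite /pack; apply: is_diff_row_mx => //.
apply: is_diff_linear_comp; first by move=> a u v; rewrite linearP.
apply: is_diff_matrix_rows => k.
apply: is_diff_linear_comp; first by move=> a u v; rewrite linearP.
exact: is_diff_col_mx.
Qed.

End Blocks.

(** * Smooth entropies *)

Section Smooth.
Context {R : realType} {m n : nat}.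
Variable eta : 'M[R]_(m, n) -> R.
Hypothesis eta_smooth : smooth eta.

Lemma smooth_differentiable A : differentiable eta A.
Proof. by have [] := eta_smooth 1. Qed.

Lemma smooth_differentiable_grad A : differentiable (grad eta) A.
Proof.
suff gA : is_diff A (grad eta)
    (fun v => \matrix_(i, j) 'd (fun B => 'D_(delta_mx i j) eta B) A v).
  exact: ex_diff.
apply: is_diff_mx => i j.
have [_ /(_ i j)[/(_ A) dij _]] := eta_smooth 2.
by apply: (is_diff_ext (differentiableP dij)) => B; rewrite mxE.
Qed.

End Smooth.

(** * The linearized IDT system *)

Section IDT.
Context {R : realType} {N s K : nat}.
Variables (f : 'rV[R]_N -> R -> 'rV[R]_N) (eta : 'rV[R]_N -> R).
Variables (rk : tableau R s) (dt : R).
Hypothesis f_diff :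
  forall (t : R) (x : 'rV[R]_N), differentiable (fun u => f u t) x.
Hypothesis eta_smooth : smooth eta.
Variable gamma : 'I_K -> 'rV[R]_N * 'M[R]_(s, N) -> R.

Implicit Types V : normedModType R.

Lemma is_diff_stage_rhs V (Y dY : V -> 'M[R]_(s, N)) x (k : 'I_K) i :
  is_diff x Y dY ->
  is_diff x (fun u => stage_rhs f rk dt k (Y u) i)
    (fun v => row i (dY v) *m stage_jac f rk dt k (Y x) i).
Proof.
move=> Yx.
have fx := differentiableP (f_diff (stage_time rk dt k i) (row i (Y x))).
apply: (is_diff_ext (is_diff_comp (is_diff_row i Yx) fx)) => // v /=.
by rewrite /stage_jac /jacobian mul_rV_lin1.
Qed.

Lemma differentiable_relax (k : 'I_K) (p : R * ('rV[R]_N * 'M[R]_(s, N))) :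
  differentiable (fun q => relax f eta rk dt k q.1 q.2) p.
Proof.
have dg := is_diff_fst (is_diff_id p).
have dy := is_diff_fst (is_diff_snd (is_diff_id p)).
have dY := is_diff_snd (is_diff_snd (is_diff_id p)).
have dF i := is_diff_stage_rhs k i dY.
have dgt := is_diff_mulr dg (is_diff_cst dt p).
have db i := is_diff_cst (rkb rk 0 i) p.
have dgrad i := is_diff_comp (is_diff_row i dY)
  (differentiableP (smooth_differentiable_grad eta_smooth _)).
have dbF := is_diff_sum (fun i => is_diff_scale (db i) (dF i)).
have dbgF := is_diff_sum
  (fun i => is_diff_mulr (db i) (is_diff_inner (dgrad i) (dF i))).
have deta u := differentiableP (smooth_differentiable eta_smooth u).
have dynext := is_diff_comp (is_diffD dy (is_diff_scale dgt dbF)) (deta _).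
have dyprev := is_diff_comp dy (deta _).
have drelax := is_diffB (is_diffB dynext dyprev) (is_diff_mulr dgt dbgF).
exact: (@ex_diff _ _ _ _ _ _ _ drelax).
Qed.

Lemma gamma_gradE (y : bar_vec R N s K) (k : 'I_K) :
  implicit_root f eta rk dt gamma y ->
  let z := local y k in
  let g := gamma k z in
  gamma_grad_y gamma k z =
    - (relax_dgamma f eta rk dt k g z)^-1 *: relax_grad_y f eta rk dt k g z /\
  gamma_grad_Y gamma k z =
    - (relax_dgamma f eta rk dt k g z)^-1 *: relax_grad_Y f eta rk dt k g z.
Proof.
move=> gi z g; have [dg0 root gd] := gi k.
have Gd := differentiable_relax k (g, z).
have rd : differentiable (relax f eta rk dt k g) z := differentiable_partial2 Gd.
have main e : 'd (gamma k) z e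
    = - (relax_dgamma f eta rk dt k g z)^-1 * 'd (relax f eta rk dt k g) z e.
  have /eqP := implicit_diff Gd gd root e.
  rewrite addr_eq0 => /eqP E; apply: (mulIf dg0); rewrite [LHS]E.
  by rewrite mulNr mulNr mulrAC mulVf // mul1r.
(* A gradient entry is the derivative along an elementary matrix, so [main] is
   used at the directions [(delta_mx i j, 0)] and [(0, delta_mx i j)]. *)
split; apply/matrixP => i j; rewrite !mxE.
- rewrite (deriveE _ (differentiable_partial1 gd)) (diff_partial1 _ gd).
  by rewrite (deriveE _ (differentiable_partial1 rd)) (diff_partial1 _ rd).
- rewrite (deriveE _ (differentiable_partial2 gd)) (diff_partial2 _ gd).
  by rewrite (deriveE _ (differentiable_partial2 rd)) (diff_partial2 _ rd).
Qed.

(** The map [u |-> local u k] is linear, and the differential of [gamma_k]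
    splits over the two factors into the inner products that define [rho]. *)
Lemma is_diff_gamma (y : bar_vec R N s K) (k : 'I_K) :
  differentiable (gamma k) (local y k) ->
  is_diff y (fun u => gamma k (local u k)) (fun v => rho gamma y v k).
Proof.
move=> gd.
have lx : is_diff y (fun u => local u k) (fun v => local v k).
  exact: (is_diff_pair (is_diff_linear y (prev_step_linear k))
                       (is_diff_linear y (stages_linear k))).
apply: (is_diff_ext (is_diff_comp lx (differentiableP gd))) => // v.
rewrite /rho /gamma_grad_y /gamma_grad_Y.
rewrite -diff_grad; last exact: (differentiable_partial1 gd).
rewrite -diff_grad; last exact: (differentiable_partial2 gd).
rewrite (diff_partial1 _ gd) (diff_partial2 _ gd) -linearD.
by congr ('d _ _ _); congr pair; rewrite /= ?addr0 ?add0r.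
Qed.

Definition linearized_state (y v : bar_vec R N s K) : bar_vec R N s K :=
  pack (init v)
    (fun k => \matrix_(i < s)
       (row i (stages v k) - prev_step v k
        - dt *: \sum_j rka rk i j *:
            (row j (stages v k) *m stage_jac f rk dt k (stages y k) j)))
    (fun k => step v k - prev_step v k
       - ((rho gamma y v k * dt)
            *: \sum_i rkb rk 0 i *: stage_rhs f rk dt k (stages y k) i
          + (gamma k (local y k) * dt) *: \sum_i rkb rk 0 i *:
            (row i (stages v k) *m stage_jac f rk dt k (stages y k) i))).

Lemma is_diff_reduced_state yinit (y : bar_vec R N s K) :
  (forall k, differentiable (gamma k) (local y k)) ->
  is_diff y (reduced_state f rk dt gamma yinit) (linearized_state y).
Proof.
move=> gd.
have init_d := is_diff_linear y init_linear.
have stages_d k := is_diff_linear y (stages_linear k).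
have step_d k := is_diff_linear y (step_linear k).
have prev_d k := is_diff_linear y (prev_step_linear k).
have sum_d (c : 'I_s -> R) k : is_diff y
    (fun u => \sum_i c i *: stage_rhs f rk dt k (stages u k) i)
    (fun v => \sum_i c i *:
       (row i (stages v k) *m stage_jac f rk dt k (stages y k) i)).
  by apply: is_diff_sum => i; apply: is_diffZ; exact: is_diff_stage_rhs.
apply: is_diff_pack => [|k|k].
- apply: (is_diff_ext (is_diffB init_d (is_diff_cst yinit y))) => // v.
  exact: subr0.
- apply: is_diff_matrix_rows => i.
  exact: (is_diffB (is_diffB (is_diff_row i (stages_d k)) (prev_d k))
                   (is_diffZ dt (sum_d (rka rk i) k))).
- apply: is_diffB (is_diffB (step_d k) (prev_d k)) _.
  have gdt_d : is_diff y (fun u => gamma k (local u k) * dt)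
                         (fun v => rho gamma y v k * dt).
    have g_d := is_diff_gamma (gd k).
    apply: (is_diff_ext (is_diff_mulr g_d (is_diff_cst dt y))) => // v.
    by rewrite /= mulr0 addr0.
  exact: (is_diff_scale gdt_d (sum_d _ k)).
Qed.

Lemma sub2_eqP (U : zmodType) (p q r t : U) :
  p - q - r = t <-> p = q + r + t.
Proof.
by rewrite -addrA -opprD addrC; split=> [<-|->]; rewrite ?addNKr ?addKr.
Qed.

Lemma linearized_state_eqP (y d w : bar_vec R N s K) :
  linearized_state y d = w <-> forward_substitution f rk dt gamma y w d.
Proof.
rewrite pack_eqP; split=> -[dw st]; split=> // k; have [Yk yk] := st k; split.
- by move=> i; apply/sub2_eqP; rewrite -Yk rowK.
- rewrite -[prev_step d k + _ + _]addrA [X in _ + X + _]addrC; exact/sub2_eqP.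
- by apply/row_matrixP => i; rewrite rowK; apply/sub2_eqP.
- apply/sub2_eqP; rewrite yk; congr (_ + _).
  by rewrite -addrA [X in _ + X]addrC.
Qed.

End IDT.

Theorem lemma1 (R : realType) (N s K : nat)
  (f : 'rV[R]_N -> R -> 'rV[R]_N) (eta : 'rV[R]_N -> R)
  (rk : tableau R s) (dt : R) (yinit : 'rV[R]_N)
  (gamma : 'I_K -> 'rV[R]_N * 'M[R]_(s, N) -> R)
  (y : bar_vec R N s K)
  (f_diff : forall (t : R) (x : 'rV[R]_N), differentiable (fun u => f u t) x)
  (eta_smooth : smooth eta)
  (eta_convex : convex_function [set: convex_lmodType 'rV[R]_N] eta)
  (dt_gt0 : 0 < dt)
  (y_idt : idt_solution f eta rk dt yinit y (fun k => gamma k (local y k)))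
  (gamma_implicit : implicit_root f eta rk dt gamma y) :
  (forall k : 'I_K,
     let z := local y k in
     let g := gamma k z in
     gamma_grad_y gamma k z =
       - (relax_dgamma f eta rk dt k g z)^-1 *: relax_grad_y f eta rk dt k g z /\
     gamma_grad_Y gamma k z =
       - (relax_dgamma f eta rk dt k g z)^-1 *: relax_grad_Y f eta rk dt k g z) /\
  (forall w d : bar_vec R N s K,
     d *m 'J (reduced_state f rk dt gamma yinit) y = w <->
     forward_substitution f rk dt gamma y w d).
Proof.
split=> [k|w d]; first exact: gamma_gradE.
have gd k : differentiable (gamma k) (local y k).
  by have [] := gamma_implicit k.
have Ed := is_diff_reduced_state rk dt f_diff yinit gd.
rewrite /jacobian mul_rV_lin1 (is_diffE Ed).
exact: linearized_state_eqP.
Qed.
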